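(* Let $R$ be a noetherian domain of prime characteristic $p>0$, $\mathfrak{a}\subset R$ a nonzero ideal, and $t\in\mathbb{R}_{>0}$. Then ${}^{\mathfrak{a}^t}R^F$ is a subring of $\overline{R}$, the normalization of $R$ (its integral closure in $\operatorname{Frac}(R)$).
   Context: All rings are commutative with unit and noetherian. $I^{[p^e]}$ is the ideal generated by $\{r^{p^e}\mid r\in I\}$. The Vraciu $\mathfrak{a}^t$-Frobenius closure of an ideal $I$ is $${}^{\mathfrak{a}^t}I^F=\{x\in R\mid\text{for all }e\gg0,\ x^{p^e}\mathfrak{a}^{\lceil tp^e\rceil}\subset\mathfrak{a}^{\lceil tp^e\rceil}I^{[p^e]}\}.$$ The Vraciu $\mathfrak{a}^t$-weak normalization of $R$ is $${}^{\mathfrak{a}^t}R^F=\{x/y\in\operatorname{Frac}(R)\mid x\in{}^{\mathfrak{a}^t}(y)^F\}$$ (membership does not depend on the representation of the fraction). *)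

(* Defs.v *)
From mathcomp Require Import all_boot all_order all_algebra.
From mathcomp Require Import boolp classical_sets reals.

Set Implicit Arguments.
Unset Strict Implicit.
Unset Printing Implicit Defensive.

Import Order.TTheory GRing.Theory Num.Theory.
Local Open Scope classical_set_scope.
Local Open Scope ring_scope.

Section Ideals.
Context {R : comNzRingType}.
Implicit Types (I J G : set R) (s : seq R).

(* The predicate idealr_closed of ring_quotient only describes proper ideals;
   here the unit ideal is allowed. *)
Definition is_ideal I : Prop :=
  [/\ I 0, forall x y, I x -> I y -> I (x + y)
    & forall a x, I x -> I (a * x)].

Definition ideal_gen G : set R := smallest is_ideal G.

Definition principal_ideal (y : R) : set R := ideal_gen [set y].

Definition ideal_mul I J : set R :=
  ideal_gen [set x * y | x in I & y in J].

Definition ideal_exp I (n : nat) : set R := iter n (ideal_mul I) [set: R].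

(* I^[q]; used with q = p ^ e *)
Definition frobenius_power I (q : nat) : set R :=
  ideal_gen [set r ^+ q | r in I].

End Ideals.

Definition noetherian (R : comNzRingType) : Prop :=
  forall I : set R, is_ideal I -> exists s : seq R, I = ideal_gen [set` s].

(* The exponent ceil (t * p ^ e); the absolute value only converts the integer
   ceiling to nat, since t is positive wherever this is used. *)
Definition ceil_exp {K : realType} (t : K) (p e : nat) : nat :=
  `|Num.ceil (t * (p ^ e)%:R)|%N.

Definition vraciu_frobenius_closure {R : comNzRingType} {K : realType}
    (p : nat) (a : set R) (t : K) (I : set R) : set R :=
  [set x | exists e0 : nat, forall e : nat, (e0 <= e)%N ->
     [set x ^+ (p ^ e) * u | u in ideal_exp a (ceil_exp t p e)] `<=`
     ideal_mul (ideal_exp a (ceil_exp t p e)) (frobenius_power I (p ^ e))].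

Definition vraciu_weak_normalization {R : idomainType} {K : realType}
    (p : nat) (a : set R) (t : K) : set {fraction R} :=
  [set z | exists x y : R, [/\ y != 0, z = tofrac x / tofrac y
     & vraciu_frobenius_closure p a t (principal_ideal y) x]].

Definition normalization (R : idomainType) : set {fraction R} :=
  [set z | integralOver (@tofrac R) z].
Arguments normalization R : clear implicits.

Definition is_subring {A : nzRingType} (S : set A) : Prop :=
  subring_closed (mem S).

(* Main.v *)
Require Import Defs.
From mathcomp Require Import all_boot all_order all_algebra.
From mathcomp Require Import boolp classical_sets reals.

Import Order.TTheory GRing.Theory Num.Theory.
Local Open Scope classical_set_scope.
Local Open Scope ring_scope.

(** Write [q] for [p ^ e] and [A_e] for the power [a ^ ceil (t q)]. Since
    [(y)^[q]] is generated by [y ^ q], the condition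
    [x ^ q A_e <= A_e (y)^[q]] says exactly that the fraction [(x / y) ^ q]
    multiplies [A_e] into itself. So the weak normalization consists of the
    [z] in [Frac R] such that [z ^ q] lies in the multiplier ring
    [(A_e : A_e)] for all large [e] ([weak_normalizationP]); in particular the
    choice of the representatives [x] and [y] does not matter.

    Each multiplier ring is a subring of [Frac R], and [z |-> z ^ q] is a ring
    endomorphism in characteristic [p], so the weak normalization is a subring
    as well: two elements share a threshold [e0].

    Each [A_e] is finitely generated and nonzero. By the determinant trick
    ([multiplier_integral]) the elements of its multiplier ring are integral
    over [R]. Thus one power [z ^ q] with [q > 0] is integral, and so is [z],
    being a root of ['X^q - z ^ q]. *)

Section Ideals.
Context {R : comNzRingType}.
Implicit Types (I J G : set R).

Lemma ideal_gen_is_ideal G : is_ideal (ideal_gen G).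
Proof.
split=> [I [[I0 _ _] _] // | x y Gx Gy I IG | b x Gx I IG].
- by have [[_ ID _] _] := IG; apply: ID (Gx I IG) (Gy I IG).
- by have [[_ _ IM] _] := IG; apply: IM _ _ (Gx I IG).
Qed.

Lemma ideal_exp_is_ideal I n : is_ideal (ideal_exp I n).
Proof.
case: n => [|n]; last exact: ideal_gen_is_ideal.
by split=> *; exact: Logic.I.
Qed.

Lemma ideal_exp_expr I c n : I c -> ideal_exp I n (c ^+ n).
Proof.
move=> Ic; elim: n => [//|n IHn].
by apply: sub_gen_smallest; exists c => //; exists (c ^+ n); rewrite ?exprS.
Qed.

Lemma is_ideal_scale y J : is_ideal J -> is_ideal [set y * v | v in J].
Proof.
case=> J0 JD JM; split=> [|_ _ [u Ju <-] [v Jv <-]|b _ [u Ju <-]].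
- by exists 0; rewrite ?mulr0.
- by exists (u + v); [apply: JD | rewrite mulrDr].
- by exists (b * u); [apply: JM | rewrite mulrCA].
Qed.

Lemma ideal_gen_seqP (s : seq R) v : ideal_gen [set` s] v ->
  exists c : 'I_(size s) -> R, v = \sum_i c i * s`_i.
Proof.
pose S := [set v | exists c : 'I_(size s) -> R, v = \sum_i c i * s`_i].
apply: (_ : ideal_gen [set` s] `<=` S); apply: smallest_sub.
  split=> [|_ _ [c ->] [d ->]|b _ [c ->]].
  - by exists (fun=> 0); rewrite big1 // => i _; rewrite mul0r.
  - exists (fun i => c i + d i); rewrite -big_split /=.
    by apply: eq_bigr => i _; rewrite mulrDl.
  - exists (fun i => b * c i); rewrite mulr_sumr.
    by apply: eq_bigr => i _; rewrite mulrA.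
move=> x /= /(nthP 0) [k ks <-].
exists (fun i => (i == Ordinal ks)%:R).
rewrite (bigD1 (Ordinal ks)) //= eqxx mul1r big1 ?addr0 // => i /negPf ->.
by rewrite mul0r.
Qed.

(** Since [(r y) ^ q = r ^ q y ^ q], the Frobenius power of a principal ideal
    [(y)] is again principal, generated by [y ^ q]. *)
Lemma ideal_mul_frobenius_principal J y q : is_ideal J ->
  ideal_mul J (frobenius_power (principal_ideal y) q) =
  [set y ^+ q * v | v in J].
Proof.
move=> idJ; have [_ _ JM] := idJ; apply/seteqP; split=> [|_ [v Jv <-]].
  apply: smallest_sub; first exact: is_ideal_scale.
  move=> _ [u Ju [w yq_w <-]].
  suff [r ->] : exists r, w = y ^+ q * r.
    by exists (r * u); [apply: JM | rewrite mulrA [RHS]mulrC].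
  (* The zeroth power of [J] is the unit ideal. *)
  have idT : is_ideal [set: R] := ideal_exp_is_ideal J 0.
  have : [set y ^+ q * r | r in [set: R]] w.
    move: w yq_w; apply: smallest_sub; first exact: is_ideal_scale.
    move=> _ [w yw <-].
    have [r _ <-] : [set y * r | r in [set: R]] w.
      move: w yw; apply: smallest_sub; first exact: is_ideal_scale.
      by move=> _ ->; exists 1; rewrite ?mulr1.
    by exists (r ^+ q); rewrite ?exprMn.
  by case=> r _ <-; exists r.
apply: sub_gen_smallest; exists v => //; exists (y ^+ q); last by rewrite mulrC.
by apply: sub_gen_smallest; exists y => //; apply: sub_gen_smallest.
Qed.

End Ideals.

Section Multiplier.
Context {R : idomainType}.
Implicit Types (J : set R) (z w : {fraction R}).

(** The ring [(J : J)] inside the fraction field; it is the endomorphism ring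
    of [J] when [J] is a nonzero ideal. *)
Definition multiplier J : set {fraction R} :=
  [set z | forall u, J u -> exists2 v, J v & z * tofrac u = tofrac v].

Lemma multiplier1 J : multiplier J 1.
Proof. by move=> u Ju; exists u; rewrite ?mul1r. Qed.

Lemma multiplierB J z w : is_ideal J ->
  multiplier J z -> multiplier J w -> multiplier J (z - w).
Proof.
case=> _ JD JM Jz Jw u Ju; have [v Jv zu] := Jz u Ju; have [x Jx wu] := Jw u Ju.
exists (v - x); first by rewrite -mulN1r; apply/JD/JM.
by rewrite mulrBl zu wu rmorphB.
Qed.

Lemma multiplierM J z w :
  multiplier J z -> multiplier J w -> multiplier J (z * w).
Proof.
move=> Jz Jw u /Jw [v Jv wu]; have [x Jx zv] := Jz v Jv.
by exists x => //; rewrite -mulrA wu.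
Qed.

(** The determinant trick: if [s] generates [J], then [z s_i] is an
    [R]-combination of the [s_j], so the nonzero vector [s] is an eigenvector
    with eigenvalue [z] of a matrix over [R], whose characteristic polynomial
    is monic. *)
Lemma multiplier_integral (s : seq R) z :
    (exists2 c, ideal_gen [set` s] c & c != 0) ->
    multiplier (ideal_gen [set` s]) z ->
  integralOver (@tofrac R) z.
Proof.
move=> [c /ideal_gen_seqP [d cE] c0] Jz.
have /choice [M zM] (i : 'I_(size s)) : exists m : 'I_(size s) -> R,
    z * tofrac s`_i = tofrac (\sum_j m j * s`_j).
  have [v /ideal_gen_seqP [m ->] ->] : exists2 v, ideal_gen [set` s] v &
      z * tofrac s`_i = tofrac v.
    by apply: Jz; apply: sub_gen_smallest; rewrite /= mem_nth.
  by exists m.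
(* Eigenvectors are row vectors, so [A] is the transpose of [M]. *)
pose A := \matrix_(j, i) M i j.
exists (char_poly A); first exact: char_poly_monic.
rewrite map_char_poly -eigenvalue_root_char; apply/eigenvalueP.
exists (\row_i tofrac s`_i).
  apply/rowP=> i; rewrite !mxE zM rmorph_sum.
  by apply: eq_bigr => j _; rewrite !mxE rmorphM mulrC.
apply: contra_neq c0 => /rowP s0; rewrite cE big1 // => i _.
move/(_ i): s0; rewrite !mxE => /eqP; rewrite tofrac_eq0 => /eqP ->.
by rewrite mulr0.
Qed.

Lemma multiplier_fracP J (x y : R) : y != 0 ->
  [set x * u | u in J] `<=` [set y * v | v in J] <->
  multiplier J (tofrac x / tofrac y).
Proof.
move=> y0; have fy0 : tofrac y != 0 by rewrite tofrac_eq0.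
split=> [sub u Ju|Jxy _ [u Ju <-]].
  have [v Jv yv] : [set y * v | v in J] (x * u) by apply: sub; exists u.
  exists v => //; apply: (mulfI fy0).
  by rewrite mulrA mulrCA divff // mulr1 -!rmorphM yv.
have [v Jv uv] := Jxy u Ju; exists v => //.
apply/eqP; rewrite -tofrac_eq !tofracM -uv; apply/eqP.
by rewrite mulrA mulrCA divff // mulr1.
Qed.

End Multiplier.

Lemma integral_expr {R K : comNzRingType} {f : {rmorphism R -> K}} z n :
  (0 < n)%N -> integralOver f (z ^+ n) -> integralOver f z.
Proof.
move=> n0 zn; apply: (@integral_root_monic _ _ _ _ ('X^n - (z ^+ n)%:P)).
- by rewrite monicXnsubC.
- by rewrite rootE !hornerE subrr.
- apply/integral_poly => i; rewrite coefB coefXn coefC.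
  apply: integral_sub; first exact: integral_nat.
  by case: ifP => // _; apply: integral0.
Qed.

Lemma fraction_num_den {R : idomainType} (z : {fraction R}) :
  exists x y : R, y != 0 /\ z = tofrac x / tofrac y.
Proof.
elim/quotW: z => r; exists \n_r, \d_r; split; first exact: denom_ratioP.
have dr : tofrac \d_r != 0 by rewrite tofrac_eq0 denom_ratioP.
apply: (mulIf dr); rewrite divfK //; unlock tofrac.
(* [Ratio \d_r 1] is the representative by which [tofrac \d_r] is defined. *)
rewrite -[LHS](FracField.pi_mul r (Ratio \d_r 1)).
apply/eqmodP; rewrite /= FracField.equivfE /FracField.mulf.
by rewrite !numden_Ratio ?mulr1 ?oner_neq0 ?denom_ratioP // mulrC.
Qed.

(** The condition on [(x, y)] depends only on the fraction [x / y]: this turns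
    questions about numerators and denominators into questions about the
    rings [multiplier (ideal_exp a _)]. *)
Lemma weak_normalizationP {R : idomainType} {K : realType}
    (p : nat) (a : set R) (t : K) (z : {fraction R}) :
  vraciu_weak_normalization p a t z <->
  exists e0, forall e, (e0 <= e)%N ->
    multiplier (ideal_exp a (ceil_exp t p e)) (z ^+ (p ^ e)).
Proof.
have key (x y : R) (e : nat) : y != 0 ->
    [set x ^+ (p ^ e) * u | u in ideal_exp a (ceil_exp t p e)] `<=`
      ideal_mul (ideal_exp a (ceil_exp t p e))
        (frobenius_power (principal_ideal y) (p ^ e)) <->
    multiplier (ideal_exp a (ceil_exp t p e))
      ((tofrac x / tofrac y) ^+ (p ^ e)).
  move=> y0; rewrite ideal_mul_frobenius_principal; last first.
    exact: ideal_exp_is_ideal.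
  by rewrite expr_div_n -!tofracXn; apply: multiplier_fracP; rewrite expf_neq0.
split=> [[x [y [y0 -> [e0 xy]]]]|].
  by exists e0 => e /xy /(key _ _ _ y0).
have [x [y [y0 ->]]] := fraction_num_den z => -[e0 xy].
by exists x, y; split=> //; exists e0 => e /xy /(key _ _ _ y0).
Qed.

Theorem proposition5p4 (R : idomainType) (hR : noetherian R)
    (p : nat) (hp : p \in [pchar R])
    (a : set R) (ha : is_ideal a) (ha0 : a <> [set 0])
    (K : realType) (t : K) (ht : 0 < t) :
  is_subring (vraciu_weak_normalization p a t) /\
  vraciu_weak_normalization p a t `<=` normalization R.
Proof.
have charF : p \in [pchar {fraction R}] by rewrite (rmorph_pchar (@tofrac R)).
split; last first.
  move=> z /weak_normalizationP [e /(_ e (leqnn e)) Az].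
  apply: (@integral_expr _ _ (@tofrac R) _ (p ^ e)).
    by rewrite expn_gt0 prime_gt0 // (pcharf_prime hp).
  have [s As] := hR _ (ideal_exp_is_ideal a (ceil_exp t p e)).
  rewrite As in Az; apply: multiplier_integral Az; rewrite -As.
  have [c ac c0] : exists2 c, a c & c != 0.
    apply: contrapT => a0; apply/ha0/seteqP; split=> [c ac|_ ->]; last by case: ha.
    by apply/eqP; apply: contrapT => /negP c0; apply: a0; exists c.
  by exists (c ^+ ceil_exp t p e); [apply: ideal_exp_expr | rewrite expf_neq0].
have common z w : vraciu_weak_normalization p a t z ->
    vraciu_weak_normalization p a t w ->
    exists e0, forall e, (e0 <= e)%N ->
      multiplier (ideal_exp a (ceil_exp t p e)) (z ^+ (p ^ e)) /\
      multiplier (ideal_exp a (ceil_exp t p e)) (w ^+ (p ^ e)).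
  move=> /weak_normalizationP [m mz] /weak_normalizationP [n nw].
  by exists (maxn m n) => e; rewrite geq_max => /andP [/mz ? /nw].
split=> [|z w|z w].
- apply/mem_set/weak_normalizationP; exists 0%N => e _.
  by rewrite expr1n; apply: multiplier1.
- move=> /set_mem Wz /set_mem Ww; have [e0 We] := common _ _ Wz Ww.
  apply/mem_set/weak_normalizationP; exists e0 => e /We [ze we].
  have chq : [pchar {fraction R}].-nat (p ^ e)%N.
    by rewrite pnatX pnatE ?charF // (pcharf_prime hp).
  rewrite exprDn_pchar // exprNn_pchar //.
  by apply: multiplierB => //; apply: ideal_exp_is_ideal.
- move=> /set_mem Wz /set_mem Ww; have [e0 We] := common _ _ Wz Ww.
  apply/mem_set/weak_normalizationP; exists e0 => e /We [ze we].
  by rewrite exprMn; apply: multiplierM.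
Qed.
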